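(* Let $G$ be a Cayley graph of a (finitely generated) virtually nilpotent group. If $G$ is not isomorphic as a graph to the standard Cayley graph of $\mathbb{Z}$, then $G$ admits detours.
   Context: **Graphs.** A graph $G=(V,E)$ is a pair of sets with a boundary map from $E$ to the two-element subsets of $V$ (parallel edges allowed, no self-loops); ambient graphs are assumed connected, locally finite and infinite. A path is an alternating sequence of vertices and edges, starting and ending with a vertex, in which the two vertices next to an edge form its boundary; we identify a path with its set of edges, and $|\pi|$ is the number of edges appearing in $\pi$. A path is self-avoiding if it has no repeated vertices. **Cayley graphs.** Let $\Gamma$ be a finitely generated group, $S$ a finite set and $f:S\to\Gamma\setminus\{1\}$ a map whose image generates $\Gamma$. The unreduced Cayley graph has vertex set $\Gamma$ and edge set $\Gamma\times S$, the edge $(g,s)$ having boundary $\{g,gf(s)\}$. The reduced Cayley graph is the simple graph obtained from it by deleting parallel edges. A Cayley graph of $\Gamma$ is any such reduced or unreduced Cayley graph. The standard Cayley graph of $\mathbb{Z}$ has vertex set $\mathbb{Z}$ and exactly one edge between $n$ and $n+1$ for each $n$ (and no other edges). **Detours.** For two paths $\pi,\pi'$ with the same starting point and the same ending point and $\pi\neq\pi'$ as edge sets, $\pi'$ is an $\epsilon$-detour for $\pi$ if $|\pi'\setminus\pi|\le(1+\epsilon)|\pi\setminus\pi'|$ (set differences of edge sets). $G$ admits detours if for every $\epsilon>0$ there is some (positive integer) $C$ such that every self-avoiding path $\pi$ in $G$ of length $C$ has a self-avoiding $\epsilon$-detour. *)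

(* Defs.v *)
From mathcomp Require Import all_boot all_order all_algebra finmap.
From mathcomp Require Import boolp classical_sets functions cardinality reals.

Set Implicit Arguments.
Unset Strict Implicit.
Unset Printing Implicit Defensive.

Import Order.TTheory GRing.Theory Num.Theory.

(* Graphs, possibly with parallel edges; [card_boundary] excludes self-loops. *)
Record graph := Graph {
  vertex : choiceType;
  edge : choiceType;
  boundary : edge -> {fset vertex};
  card_boundary : forall e, #|` boundary e| = 2
}.

(* [:: (e1, v1); ...; (en, vn)] with starting vertex v0 encodes the alternating
   sequence v0, e1, v1, ..., en, vn. *)
Fixpoint is_path (G : graph) (v : vertex G) (p : seq (edge G * vertex G)) :
    bool :=
  if p is (e, w) :: p' then
    (boundary e == [fset v; w]%fset) && is_path w p'
  else true.

Record gpath (G : graph) := GPath {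
  gstart : vertex G;
  gsteps : seq (edge G * vertex G);
  gpathP : is_path gstart gsteps
}.

Definition gvertices (G : graph) (p : gpath G) : seq (vertex G) :=
  gstart p :: unzip2 (gsteps p).

Definition gend (G : graph) (p : gpath G) : vertex G :=
  last (gstart p) (unzip2 (gsteps p)).

Definition gedges (G : graph) (p : gpath G) : {fset edge G} :=
  [fset e in unzip1 (gsteps p)]%fset.

Definition glength (G : graph) (p : gpath G) : nat := #|` gedges p|.

Definition self_avoiding (G : graph) (p : gpath G) : bool :=
  uniq (gvertices p).

(* [q] is an [eps]-detour for [p]. *)
Definition detour (R : realType) (eps : R) (G : graph) (p q : gpath G) : Prop :=
  [/\ gstart q = gstart p, gend q = gend p, gedges q <> gedges p &
      ((#|` gedges q `\` gedges p|%fset)%:R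
         <= (1 + eps) * (#|` gedges p `\` gedges q|%fset)%:R)%R].

Definition admits_detours (R : realType) (G : graph) : Prop :=
  forall eps : R, (0 < eps)%R ->
  exists2 C : nat, 0 < C &
    forall p : gpath G, self_avoiding p -> glength p = C ->
    exists2 q : gpath G, self_avoiding q & detour eps p q.

Definition graph_isomorphic (G H : graph) : Prop :=
  exists (phi : vertex G -> vertex H) (psi : edge G -> edge H),
    [/\ bijective phi, bijective psi &
        forall e, boundary (psi e) = [fset phi v | v in boundary e]%fset].

(* Deleting parallel edges: the edges of the resulting simple graph are the
   two-element sets that are the boundary of some edge of [G]. *)
Definition simple_edge (G : graph) : choiceType :=
  {A : {fset vertex G} | `[< exists e : edge G, boundary e = A >]}.

Lemma card_simple_edge (G : graph) (A : simple_edge G) : #|` val A| = 2.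
Proof. by have /asboolP[e <-] := valP A; exact: card_boundary. Qed.

Definition simplification (G : graph) : graph := Graph (@card_simple_edge G).

Lemma card_int_edge (n : int) : #|` [fset n; (n + 1)%R]%fset| = 2.
Proof. by rewrite cardfs2 -[X in X == _]addr0 (inj_eq (addrI n)). Qed.

(* The standard Cayley graph of the integers: [n] is the edge {n, n + 1}. *)
Definition standard_int_graph : graph := Graph card_int_edge.

Local Open Scope group_scope.
Local Open Scope classical_set_scope.

Definition subgroup (Gamma : groupType) (H : set Gamma) : Prop :=
  H 1 /\ forall x y, H x -> H y -> H (x / y).

Definition generated_subgroup (Gamma : groupType) (A : set Gamma) :
  set Gamma := smallest (@subgroup Gamma) A.

Definition commutator_subgroup (Gamma : groupType) (A B : set Gamma) :
    set Gamma :=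
  generated_subgroup [set [~ x, y] | x in A & y in B].

Fixpoint lower_central (Gamma : groupType) (H : set Gamma) (n : nat) :
    set Gamma :=
  if n is m.+1 then commutator_subgroup (lower_central H m) H else H.

Definition nilpotent_subgroup (Gamma : groupType) (H : set Gamma) : Prop :=
  subgroup H /\ exists n : nat, lower_central H n = [set 1].

Definition finite_index (Gamma : groupType) (H : set Gamma) : Prop :=
  finite_set (range (fun g : Gamma => [set g * h | h in H])).

Definition virtually_nilpotent (Gamma : groupType) : Prop :=
  exists2 H : set Gamma, nilpotent_subgroup H & finite_index H.

Definition cayley_boundary (Gamma : groupType) (S : finType) (f : S -> Gamma)
    (e : Gamma * S) : {fset Gamma} :=
  [fset e.1; e.1 * f e.2]%fset.

Lemma card_cayley_boundary (Gamma : groupType) (S : finType) (f : S -> Gamma)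
    (f_neq1 : forall s, f s != 1) (e : Gamma * S) :
  #|` cayley_boundary f e| = 2.
Proof.
by rewrite cardfs2 -[X in X == _]mulg1 (inj_eq (mulgI e.1)) eq_sym f_neq1.
Qed.

Definition unreduced_cayley_graph (Gamma : groupType) (S : finType)
    (f : S -> Gamma) (f_neq1 : forall s, f s != 1) : graph :=
  Graph (card_cayley_boundary f_neq1).

Definition reduced_cayley_graph (Gamma : groupType) (S : finType)
    (f : S -> Gamma) (f_neq1 : forall s, f s != 1) : graph :=
  simplification (unreduced_cayley_graph f_neq1).

(* The existence of a Cayley graph includes the finite generation of [Gamma];
   Cayley graphs are connected and locally finite by construction. *)
Inductive cayley_graph (Gamma : groupType) : graph -> Prop :=
| UnreducedCayley (S : finType) (f : S -> Gamma)
    (f_neq1 : forall s, f s != 1)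
    (f_gen : generated_subgroup (range f) = [set: Gamma]) :
    cayley_graph Gamma (unreduced_cayley_graph f_neq1)
| ReducedCayley (S : finType) (f : S -> Gamma)
    (f_neq1 : forall s, f s != 1)
    (f_gen : generated_subgroup (range f) = [set: Gamma]) :
    cayley_graph Gamma (reduced_cayley_graph f_neq1).

(* Main.v *)
Require Import Defs.
From mathcomp Require Import all_boot all_order all_algebra finmap.
From mathcomp Require Import boolp classical_sets functions cardinality reals.
From mathcomp Require Import zify.

(** A self-avoiding path that is not a shortest path between its endpoints has
    a shorter self-avoiding competitor, which is a detour for every eps
    ([detour_of_shortcut]). So let p be geodesic, with vertices x_0, ..., x_C.
    For such a p it is enough to find an excursion: a walk that leaves p at
    x_a, meets p again only at x_b, and has length at most (1 + 1/m)(b - a),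
    where 1/m <= eps; splicing it into p gives the detour
    ([detour_of_excursion]). If there are no excursions, every visit of a walk
    to a vertex off p costs a fixed extra amount of length; hence a walk
    between two vertices of p whose length exceeds their distance by a bounded
    amount, but which meets many vertices off p, produces an excursion
    ([excursion_of_walk]).

    Virtual nilpotency enters through a finite, nonempty, conjugation-invariant
    set Z of nontrivial elements: the conjugacy class of a nontrivial element
    of the last nontrivial term of the lower central series of a nilpotent
    subgroup of finite index ([finite_conjugation_invariant_set]). As
    z * g = g * z ^ g with z ^ g in the finite set Z, left translation by an
    element of Z moves all vertices by at most a constant M. Hence the
    translate z p stays close to p, and going from x_0 to z p, along z p and
    back to x_C is a walk of length at most C + 2M. If z p has many vertices
    off p for some z in Z, this is the required walk ([translate_count]).
    Otherwise, for C large, p has a long stretch on which every z in Z acts as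
    a shift of p: z * x_k = x_(k + t_z) with t_z <> 0 ([geodesic_shift]).

    Suppose now that each vertex has at least three neighbours. Then some
    neighbour y of a vertex x_k of that stretch is off p. Write y = a * x_k,
    choose z0 in Z with |t_z0| minimal, and let z1 = a z0 a^-1, again in Z.
    Since a * x_(k + n t_z0) = a z0^n x_k = z1^n y is adjacent to
    z1^n x_k = x_(k + n t_z1), the walk that steps from x_k to y, follows a p
    up to z1^n y and steps back to p has length n |t_z0| + 2 <= n |t_z1| + 2;
    and its vertices y, z1 y, ..., z1^n y are off p, because y is and z1
    shifts p. This is the required walk ([excursion_of_periodic]).

    An infinite connected vertex-transitive graph with fewer than three
    neighbours at a vertex is, up to parallel edges, a bi-infinite line
    ([line_inj], [line_surj]). Without parallel edges it is the standard Cayley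
    graph of the integers ([line_isomorphic]); with parallel edges, every
    self-avoiding path of length 2 can swap an edge for a parallel one
    ([admits_detours_of_parallel]). *)

Set Implicit Arguments.
Unset Strict Implicit.
Unset Printing Implicit Defensive.

Import Order.TTheory GRing.Theory Num.Theory.

(** * Geodesics and excursions *)

Section Geodesics.
Variables (V : eqType) (E : rel V).

(** The distance |i - j| in the natural numbers. *)
Definition gap (i j : nat) := (i - j) + (j - i).

Definition geodesic (x : nat -> V) (C : nat) :=
  (forall i, i < C -> E (x i) (x i.+1)) /\
  forall i j s, i <= C -> j <= C -> path E (x i) s -> last (x i) s = x j ->
    gap i j <= size s.

(** The steps of the excursion lead from [x a] through [t] to [x b], so its length
    is [(size t).+1]. *)
Definition excursion (m : nat) (x : nat -> V) (C a b : nat) (t : seq V) :=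
  [/\ a < b <= C, path E (x a) (rcons t (x b)), t != [::],
      all (fun v => v \notin mkseq x C.+1) t &
      m * (size t).+1 <= m.+1 * (b - a)].

Definition has_excursion m x C := exists a b t, excursion m x C a b t.

(** The vertices met after [x i] on the way along [x] from [x i] to [x j], in
    either direction. *)
Definition stretch (x : nat -> V) (i j : nat) : seq V :=
  if i <= j then [seq x k | k <- iota i.+1 (j - i)]
  else [seq x k | k <- rev (iota j (i - j))].

Lemma mem_mkseq (x : nat -> V) n v :
  reflect (exists2 k, k < n & v = x k) (v \in mkseq x n).
Proof.
apply: (iffP mapP) => -[k]; first by rewrite mem_iota add0n; exists k.
by move=> hk ->; exists k; rewrite // mem_iota add0n.
Qed.

Lemma path_stretch_up (x : nat -> V) i n :
  (forall k, i <= k < i + n -> E (x k) (x k.+1)) ->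
  path E (x i) [seq x k | k <- iota i.+1 n] /\
  last (x i) [seq x k | k <- iota i.+1 n] = x (i + n).
Proof.
elim: n i => [|n IH] i hE /=; first by rewrite addn0.
have [|h1 h2] := IH i.+1; first by move=> k hk; apply: hE; lia.
by rewrite h1 h2 addSnnS hE //; lia.
Qed.

Hypothesis E_sym : symmetric E.

Lemma path_rev u t w :
  path E u (rcons t w) -> path E w (rcons (rev t) u).
Proof.
move=> p; have := rev_path E u (rcons t w).
rewrite last_rcons belast_rcons rev_cons => ->.
by under eq_path do rewrite E_sym.
Qed.

Section Stretch.
Variables (x : nat -> V) (C : nat).
Hypothesis geo : geodesic x C.

Lemma geodesic_inj i j : i <= C -> j <= C -> x i = x j -> i = j.
Proof. by move=> iC jC e; have := geo.2 i j [::] iC jC isT e; rewrite /gap /=; lia. Qed.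

Lemma size_stretch i j : size (stretch x i j) = gap i j.
Proof.
by rewrite /stretch /gap; case: ifP; rewrite size_map ?size_rev size_iota; lia.
Qed.

Lemma mem_stretch i j k : i != k -> (i <= k <= j) || (j <= k <= i) ->
  x k \in stretch x i j.
Proof.
move=> ik h; rewrite /stretch; case: ifP => ij; apply: map_f;
  rewrite ?mem_rev mem_iota; lia.
Qed.

Lemma path_stretch i j : i <= C -> j <= C ->
  path E (x i) (stretch x i j) /\ last (x i) (stretch x i j) = x j.
Proof.
move=> iC jC; rewrite /stretch; case: ifP => ij.
  have [|p l] := @path_stretch_up x i (j - i); first by move=> k hk; apply: geo.1; lia.
  by split; rewrite // l; congr x; lia.
have [|p l] := @path_stretch_up x j (i - j); first by move=> k hk; apply: geo.1; lia.
have [d ed] : exists d, i - j = d.+1 by (exists (i - j).-1; lia).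
rewrite ed in p l *.
have ei : iota j.+1 d.+1 = rcons (iota j.+1 d) i.
  by rewrite -{1}(addn1 d) iotaD cats1; congr rcons; lia.
rewrite ei map_rcons in p; have := path_rev p.
by rewrite [iota j _]/= rev_cons map_rcons map_rev last_rcons.
Qed.

End Stretch.

Variables (x : nat -> V) (C m : nat).
Hypothesis m_gt0 : 0 < m.
Hypothesis geo : geodesic x C.
Let off := fun v => v \notin mkseq x C.+1.

(** Cut the walk at its visits to the geodesic. A piece with [l] steps from [x i]
    to [x k] that runs off the geodesic is not an excursion, so
    [m * l > m.+1 * gap i k], that is, [m.+1 * l >= m.+1 * gap i k + l + 1]: the
    piece pays for the [l - 1] vertices it has off the geodesic. *)
Lemma long_walk_of_no_excursion : ~ has_excursion m x C ->
  forall s i j, i <= C -> j <= C -> path E (x i) s -> last (x i) s = x j ->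
  m.+1 * gap i j + count off s <= m.+1 * size s.
Proof.
move=> noex s; move: {2}(size s) (leqnn (size s)) => n.
elim: n s => [|n IH] s hn i j iC jC ps ls.
  have := geo.2 i j s iC jC ps ls; case: s hn {ps ls} => //= _; lia.
case: (posnP (size s)) => [/size0nil s0|spos].
  have := geo.2 i j s iC jC ps ls; rewrite s0 /=; lia.
have on_s : has (mem (mkseq x C.+1)) s.
  apply/hasP; exists (x j).
    by rewrite -ls; case: (s) spos => //= v s' _; exact: mem_last.
  by apply/mem_mkseq; exists j.
case/split_find: on_s hn ps ls spos => v s1 s2 /= /mem_mkseq[k kC ->{v}] offs1.
have {}offs1 : all off s1 by rewrite all_predC.
rewrite size_cat size_rcons cat_path last_rcons last_cat last_rcons.
move=> hn /andP[p1 p2] l2 _.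
have {IH} := IH s2 _ k j kC jC p2 l2.
rewrite count_cat -cats1 count_cat /= {3}/off.
have -> : x k \in mkseq x C.+1 by apply/mem_mkseq; exists k.
have -> /= : count off s1 = size s1 by apply/eqP; rewrite -all_count.
have := geo.2 i k _ iC kC p1; rewrite last_rcons size_rcons => /(_ erefl) gik.
case: (eqVneq s1 [::]) => [-> | s1n] in offs1 p1 hn gik *.
  rewrite /gap /= in gik *; nia.
have : ~ m * (size s1).+1 <= m.+1 * gap i k.
  move=> good; apply: noex; case: (ltngtP i k) => ik.
  - exists i, k, s1; split => //; first lia; move: good; rewrite /gap; nia.
  - exists k, i, (rev s1); split; rewrite ?all_rev ?size_rev //; first lia.
    + exact: path_rev.
    + by rewrite -size_eq0 size_rev size_eq0.
    + move: good; rewrite /gap; nia.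
  - move: good; rewrite ik /gap subnn; nia.
rewrite /gap in gik *; nia.
Qed.

Lemma excursion_of_walk D s i j : i <= C -> j <= C -> path E (x i) s ->
  last (x i) s = x j -> size s <= gap i j + D -> m.+1 * D < count off s ->
  has_excursion m x C.
Proof.
move=> iC jC ps ls hs hD; apply: contrapT => /long_walk_of_no_excursion H.
have := H s i j iC jC ps ls; nia.
Qed.

End Geodesics.

Lemma crossed_inj (t M l l' : nat) :
  t <> M -> l * t + l' * M = l' * t + l * M -> l = l'.
Proof. by move=> tM e; nia. Qed.

(** Split the interval into [N.+1] blocks of length [L]; one of them avoids [b]. *)
Lemma run_of_count (b : pred nat) N L s : count b (iota s (N.+1 * L)) <= N ->
  exists k0, [/\ s <= k0, k0 + L <= s + N.+1 * L &
    forall k, k0 <= k < k0 + L -> ~~ b k].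
Proof.
elim: N s => [|N IH] s.
  rewrite mul1n => hb; exists s; split=> // k hk; apply/negP => bk.
  have : has b (iota s L) by apply/hasP; exists k => //; rewrite mem_iota.
  by rewrite has_count; lia.
rewrite mulSn iotaD count_cat => hb.
have [hs|hs] := boolP (has b (iota s L)).
  have [|k0 [h1 h2 h3]] := IH (s + L); first by move: hs; rewrite has_count; lia.
  by exists k0; split=> //; lia.
exists s; split=> //; first lia.
by move=> k hk; apply: contra hs => bk; apply/hasP; exists k; rewrite // mem_iota.
Qed.

Lemma count_has_le (T U : eqType) (P : U -> pred T) (Z : seq U) (s : seq T) B :
  (forall z, z \in Z -> count (P z) s <= B) ->
  count (fun k => has (P^~ k) Z) s <= size Z * B.
Proof.
elim: Z => [|z Z IH] h /=; first by rewrite count_pred0.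
have := count_predUI (P z) (fun k => has (P^~ k) Z) s.
have := h z (mem_head _ _).
have : count (fun k => has (P^~ k) Z) s <= size Z * B.
  by apply: IH => u uZ; apply: h; rewrite inE uZ orbT.
by rewrite /predU /=; under [X in count X _ + _]boolp.funext do rewrite !inE; lia.
Qed.

(** * Translates of a geodesic in a group *)

Section Core.
Local Open Scope group_scope.
Variables (Gamma : groupType) (E : rel Gamma).
Hypothesis E_left : forall g u v, E (g * u) (g * v) = E u v.
Hypothesis E_sym : symmetric E.
Hypothesis E_irr : irreflexive E.
Hypothesis E_conn : forall u v, exists2 s, path E u s & last u s = v.
Variable Z : seq Gamma.
Hypothesis Z_conj : forall g z, z \in Z -> z ^ g \in Z.
Hypothesis Z1 : 1 \notin Z.

Lemma path_mulg g u s : path E (g * u) [seq g * v | v <- s] = path E u s.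
Proof. by rewrite path_map; apply: eq_path => v w /=; rewrite E_left. Qed.

(** Walks from [1] to the finitely many elements of [Z], translated by [g],
    lead from [g] to all [g * z]; and [z * g = g * z ^ g] with [z ^ g] in [Z]. *)
Lemma displacement_bound : exists M, forall z g, z \in Z ->
  exists s, [/\ path E g s, last g s = z * g & size s <= M].
Proof.
have [M hM] : exists M, forall z, z \in Z ->
    exists s, [/\ path E 1 s, last 1 s = z & size s <= M].
  elim: Z => [|z Y [M IH]]; first by exists 0.
  have [s ps ls] := E_conn 1 z.
  exists (maxn M (size s)) => u; rewrite inE => /predU1P[->|uY].
    by exists s; split=> //; lia.
  by have [t [pt lt st]] := IH u uY; exists t; split=> //; lia.
exists M => z g zZ; have [s [ps ls ss]] := hM _ (Z_conj g zZ).
exists [seq g * v | v <- s]; split.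
- by rewrite -[g in path E g](mulg1 g) path_mulg.
- by rewrite -[g in last g](mulg1 g) last_map ls mulVKg.
- by rewrite size_map.
Qed.

Section Shift.
Variables (M C : nat) (x : nat -> Gamma).
Hypothesis geo : geodesic E x C.
Hypothesis hM : forall z g, z \in Z ->
  exists s, [/\ path E g s, last g s = z * g & size s <= M].

Lemma geodesic_step i j : i <= C -> j <= C -> E (x i) (x j) -> gap i j <= 1.
Proof. by move=> iC jC e; apply: (geo.2 i j [:: x j]); rewrite //= e. Qed.

(** Translation by [z] maps neighbours on the geodesic to neighbours on the
    geodesic, so the index [phi k] of [z * x k] changes by one when [k] does, and
    always in the same direction because [phi] is injective. Downward is
    impossible, as [phi k] would move away from [k] by more than [M]. The shift is
    encoded by the natural number [t] that exceeds it by [M]; it is nonzero because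
    [z] has no fixed points. *)
Lemma geodesic_shift z lo hi : z \in Z -> hi <= C.+1 -> lo + M + 2 <= hi ->
  (forall k, lo <= k < hi -> z * x k \in mkseq x C.+1) ->
  exists t, [/\ t <= 2 * M, t != M & forall k, lo <= k -> k + M + 2 <= hi ->
    [/\ M <= k + t, k + t - M <= C & z * x k = x (k + t - M)]].
Proof.
move=> zZ hiC lohi hon.
have [phi hphi] : exists phi, forall k, lo <= k < hi ->
    phi k <= C /\ z * x k = x (phi k).
  suff /choice[phi hphi] : forall k, exists j, lo <= k < hi ->
      j <= C /\ z * x k = x j by exists phi.
  move=> k; case: (boolP (lo <= k < hi)) => [hk|_]; last by exists 0.
  by have /mem_mkseq[j jC e] := hon k hk; exists j.
have near k : lo <= k < hi -> gap k (phi k) <= M.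
  move=> hk; have [pC e] := hphi k hk; have [s [ps ls ss]] := hM (x k) zZ.
  by apply: leq_trans ss; apply: geo.2 ps _; rewrite ?ls //; lia.
have inj j k : lo <= j < hi -> lo <= k < hi -> phi j = phi k -> j = k.
  move=> hj hk e; have [_ ej] := hphi j hj; have [_ ek] := hphi k hk.
  apply: (geodesic_inj geo); [lia|lia|].
  by apply: (mulgI z); rewrite ej ek e.
have step k : lo <= k -> k.+1 < hi -> gap (phi k) (phi k.+1) = 1%N.
  move=> h1 h2; have [|pk ek] := hphi k; first lia.
  have [|pk' ek'] := hphi k.+1; first lia.
  have := @geodesic_step (phi k) (phi k.+1) pk pk'.
  rewrite -ek -ek' E_left geo.1; last lia.
  have := @inj k k.+1; rewrite /gap; lia.
have up k : lo <= k -> k + M + 2 <= hi -> phi k.+1 = (phi k).+1.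
  move=> h1 h2; have := step k h1; have [//|ne] := eqVneq (phi k.+1) (phi k).+1.
  move=> /(_ ltac:(lia)) st0.
  have down j : k + j.+1 < hi ->
      phi (k + j) + j = phi k /\ phi (k + j.+1) + j.+1 = phi k.
    elim: j => [|j IH] hj; first by rewrite !addn0 !addn1; move: st0; rewrite /gap; lia.
    have [|e1 e2] := IH; first lia.
    have := step (k + j.+1); have := @inj (k + j) (k + j.+2).
    rewrite /gap -!addnS; lia.
  have [|_] := down M; first lia.
  have := near (k + M.+1); have := near k; rewrite /gap; lia.
have lin k : lo <= k -> k + M + 2 <= hi -> phi k + lo = phi lo + k.
  move=> h1; have -> : k = lo + (k - lo) by lia.
  elim: (k - lo) => [|d IH] h; first by rewrite addn0.
  by rewrite addnS up ?addSn ?IH; lia.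
exists (phi lo + M - lo).
have := near lo; rewrite {1}/gap => hlo.
split; first lia.
  apply/eqP => e; have [|_ elo] := hphi lo; first lia.
  move: Z1; have -> : 1 = z; last by rewrite zZ.
  by apply: (mulIg (x lo)); rewrite mul1g elo; congr x; lia.
move=> k h1 h2; have [|pk ek] := hphi k; first lia.
have := lin k h1 h2 => h; have ei : k + (phi lo + M - lo) - M = phi k by lia.
by rewrite ei; split=> //; lia.
Qed.

(** Joining the ends of the geodesic to those of its translate by [z] gives a walk
    that exceeds the distance of its endpoints by at most [M + M]. *)
Lemma translate_count m z : 0 < m -> ~ has_excursion E m x C -> z \in Z ->
  count (fun k => z * x k \notin mkseq x C.+1) (iota 1 C) <= m.+1 * (M + M).
Proof.
move=> m0 noex zZ; rewrite leqNgt; apply/negP => big; apply: noex.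
have [s1 [p1 l1 h1]] := hM (x 0) zZ; have [s2 [p2 l2 h2]] := hM (x C) zZ.
have [s3 [p3 l3 h3]] : exists s3, [/\ path E (z * x C) s3,
    last (z * x C) s3 = x C & size s3 = size s2].
  case: (lastP s2) p2 l2 => [|s v] /= p2 l2; first by exists [::]; rewrite -l2.
  rewrite last_rcons in l2; subst v; exists (rcons (rev s) (x C)).
  by rewrite last_rcons !size_rcons size_rev path_rev.
have [ps ls] := path_stretch E_sym geo (leq0n C) (leqnn C).
pose w := s1 ++ [seq z * v | v <- stretch x 0 C] ++ s3.
apply: (excursion_of_walk E_sym m0 geo (D := M + M) (s := w) (leq0n C) (leqnn C)).
- by rewrite /w !cat_path p1 l1 path_mulg ps last_map ls p3.
- by rewrite /w !last_cat l1 last_map ls.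
- by rewrite /w !size_cat size_map size_stretch addnCA leq_add2l h3 leq_add.
- apply: leq_trans big _; rewrite /w !count_cat /stretch /= subn0 !count_map.
  by rewrite addnCA leq_addr.
Qed.

End Shift.

Hypothesis Z_neq0 : Z != [::].
Hypothesis three_neighbours : exists a b c : Gamma,
  [/\ E 1 a, E 1 b, E 1 c & uniq [:: a; b; c]].

(** The geodesic meets the neighbours of [x k] only at indices [k - 1] and [k + 1]. *)
Lemma neighbour_off_geodesic x C k : geodesic E x C -> k <= C ->
  exists2 y, E (x k) y & y \notin mkseq x C.+1.
Proof.
move=> geo kC; have [a [b [c [Ea Eb Ec]]]] := three_neighbours.
rewrite /= !inE andbT negb_or => /andP[/andP[/eqP ab /eqP ac] /eqP bc].
apply: contrapT => no.
have on g : E 1 g -> exists j, [/\ j <= C, x k * g = x j, j != k & gap k j <= 1].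
  move=> Eg; have Exg : E (x k) (x k * g) by rewrite -{1}[x k]mulg1 E_left.
  have /mem_mkseq[j jC e] : x k * g \in mkseq x C.+1.
    by apply: contrapT => /negP h; apply: no; exists (x k * g).
  exists j; split=> //; last by apply: (geodesic_step geo); rewrite -?e.
  apply/eqP => jk; move: e; rewrite jk -{2}[x k]mulg1 => /mulgI g1.
  by move: Eg; rewrite g1 E_irr.
have [ja [ca ea na ga]] := on a Ea; have [jb [cb eb nb gb]] := on b Eb.
have [jc [cc ec nc gc]] := on c Ec.
have nab : ja <> jb by move=> e; apply: ab; apply: (mulgI (x k)); rewrite ea eb e.
have nac : ja <> jc by move=> e; apply: ac; apply: (mulgI (x k)); rewrite ea ec e.
have nbc : jb <> jc by move=> e; apply: bc; apply: (mulgI (x k)); rewrite eb ec e.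
rewrite /gap in ga gb gc; lia.
Qed.

Section Periodic.
Variables (m M C lo hi : nat) (x : nat -> Gamma).
Hypothesis m_gt0 : 0 < m.
Hypothesis geo : geodesic E x C.
Hypothesis hi_le : hi <= C.+1.
Variable t : Gamma -> nat.
Hypothesis shift : forall z, z \in Z ->
  [/\ t z <= 2 * M, t z != M & forall i, lo <= i < hi ->
    [/\ M <= i + t z, i + t z - M <= C & z * x i = x (i + t z - M)]].
Variable n : nat.
Hypothesis n_big : m.+1 * 2 < n.
Variable k : nat.
Hypothesis k_lo : lo + n * M + M + 3 <= k.
Hypothesis k_hi : k + n * M + M + 3 <= hi.

(** The bounds on [k] keep all intermediate indices inside the interval where the
    elements of [Z] act as shifts. *)
Lemma shift_pow z l i : z \in Z -> l <= n -> gap k i <= 1 ->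
  z ^+ l * x i = x (i + l * t z - l * M).
Proof.
move=> zZ ln ik; have [tM _ st] := shift zZ.
elim: l ln => [|l IH] ln; first by rewrite mul1g; congr x; lia.
have hl : l * t z <= l * M + l * M by rewrite -mulnDr leq_mul2l addnn -mul2n tM orbT.
have hM : l.+1 * M <= n * M by rewrite leq_mul2r ln orbT.
rewrite mulSn in hM; rewrite /gap in ik.
rewrite expgS -mulgA IH; last lia.
have [|h1 h2 ->] := st (i + l * t z - l * M); first lia.
by congr x; rewrite !mulSn; lia.
Qed.

(** Translating by [a], which moves [x k] to a neighbour [y] off the geodesic,
    turns the shift by [z0] into the shift by its conjugate [z1]. Minimality of the
    shift of [z0] makes the translate by [a] at most as long as the part of the
    geodesic that it bypasses. *)
Lemma excursion_of_periodic : has_excursion E m x C.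
Proof.
have kC : k <= C by lia.
have [y Exy offy] := neighbour_off_geodesic geo kC.
have [z0 z0Z z0min] : exists2 z0, z0 \in Z &
    forall z, z \in Z -> gap (t z0) M <= gap (t z) M.
  have ex : exists d, has (fun z => gap (t z) M == d) Z.
    case: Z Z_neq0 => [|z Y] // _; exists (gap (t z) M) => /=.
    by rewrite eqxx.
  case: (ex_minnP ex) => d /hasP[z0 z0Z /eqP <-] hd; exists z0 => // z zZ.
  by apply: hd; apply/hasP; exists z.
have [a ak] : exists a, a * x k = y by exists (y * (x k)^-1); rewrite mulgVK.
pose z1 := z0 ^ a^-1; have z1Z : z1 \in Z by exact: Z_conj.
have conj l : a * z0 ^+ l = z1 ^+ l * a.
  elim: l => [|l IH]; first by rewrite mulg1 mul1g.
  by rewrite !expgS -mulgA -IH /z1 conjgE invgK !mulgA mulgVK.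
have [t0M /eqP t0n _] := shift z0Z; have [t1M /eqP t1n _] := shift z1Z.
have min01 := z0min _ z1Z.
have kk : gap k k <= 1 by rewrite /gap subnn.
have pt l : l <= n -> a * x (k + l * t z0 - l * M) = z1 ^+ l * y.
  by move=> ln; rewrite -shift_pow // mulgA conj -mulgA ak.
have bnd z l : z \in Z -> l <= n ->
    l * M <= n * M /\ l * t z <= l * M + l * M.
  move=> zZ ln; have [tM _ _] := shift zZ.
  by rewrite leq_mul2r ln orbT -mulnDr leq_mul2l addnn -mul2n tM orbT.
have [_ b0] := bnd z0 n z0Z (leqnn n); have [_ b1] := bnd z1 n z1Z (leqnn n).
pose i0 := k + n * t z0 - n * M; pose i1 := k + n * t z1 - n * M.
have i0C : i0 <= C by rewrite /i0; lia.
have i1C : i1 <= C by rewrite /i1; lia.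
have g01 : gap k i0 <= gap k i1.
  have : n * gap (t z0) M <= n * gap (t z1) M by rewrite leq_mul2l min01 orbT.
  by rewrite /gap !mulnDr !mulnBr /i0 /i1; lia.
have [ps ls] := path_stretch E_sym geo kC i0C.
pose s := y :: [seq a * v | v <- stretch x k i0] ++ [:: x i1].
(* If z1^l y were x_r, then r would be within 1 of the index of z1^l x_k;
   shifting back by z1^-l would put y on the geodesic. *)
have off l : l <= n -> z1 ^+ l * y \notin mkseq x C.+1.
  move=> ln; apply/negP => /mem_mkseq[r rC er].
  have [lM lt] := bnd z1 l z1Z ln.
  have near : gap (k + l * t z1 - l * M) r <= 1.
    apply: (geodesic_step geo) => //; first lia.
    by rewrite -shift_pow // -er E_left.
  have := @shift_pow z1 l (r + l * M - l * t z1) z1Z ln.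
  have -> : r + l * M - l * t z1 + l * t z1 - l * M = r by rewrite /gap in near; lia.
  rewrite -er => /(_ _)/mulgI e.
  have {}e : x (r + l * M - l * t z1) = y by apply: e; rewrite /gap in near *; lia.
  move/negP: offy; apply; apply/mem_mkseq; exists (r + l * M - l * t z1) => //.
  by rewrite /gap in near; lia.
apply: (excursion_of_walk E_sym m_gt0 geo (D := 2) (s := s) kC i1C).
- rewrite /s /= Exy cat_path -ak path_mulg ps last_map ls /= andbT.
  by rewrite pt // -(@shift_pow z1 n k) // E_left E_sym.
- by rewrite /s /= last_cat.
- by rewrite /s /= size_cat size_map size_stretch /=; lia.
pose ys := [seq z1 ^+ l * y | l <- iota 1 n].
suff ys_off : size ys <= size (filter (fun v => v \notin mkseq x C.+1) s).
  by rewrite size_map size_iota size_filter in ys_off; exact: leq_trans ys_off.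
apply: uniq_leq_size.
  rewrite map_inj_in_uniq ?iota_uniq // => l l'; rewrite !mem_iota => hl hl'.
  have [lM lt] := bnd z0 l z0Z ltac:(lia).
  have [lM' lt'] := bnd z0 l' z0Z ltac:(lia).
  rewrite -!pt; [|lia|lia] => /mulgI /(geodesic_inj geo).
  move=> /(_ ltac:(lia) ltac:(lia)) e.
  by apply: (crossed_inj t0n); lia.
move=> _ /mapP[l hl ->]; rewrite mem_iota in hl.
have [lM lt] := bnd z0 l z0Z ltac:(lia).
rewrite mem_filter off /=; last lia.
rewrite /s inE mem_cat -pt; last lia.
apply/orP; right; apply/orP; left; apply: map_f; apply: mem_stretch.
  apply/eqP => e; apply: t0n; apply/eqP.
  by rewrite -(@eqn_pmul2l l); lia.
case: (leqP (t z0) M) => le.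
  have : l * (M - t z0) <= n * (M - t z0) by rewrite leq_mul2r; apply/orP; right; lia.
  have := leq_mul (leqnn l) le; have := leq_mul (leqnn n) le.
  by rewrite !mulnBr /i0; lia.
have {}le := ltnW le.
have : l * (t z0 - M) <= n * (t z0 - M) by rewrite leq_mul2r; apply/orP; right; lia.
have := leq_mul (leqnn l) le; have := leq_mul (leqnn n) le.
by rewrite !mulnBr /i0; lia.
Qed.

End Periodic.

(** The length [C] is chosen such that, without excursions, the vertices moved off
    the geodesic by some element of [Z] are too few to meet every block of
    length [L]. *)
Theorem geodesic_excursions m : 0 < m ->
  exists2 C, 0 < C & forall x, geodesic E x C -> has_excursion E m x C.
Proof.
move=> m_gt0; have [M hM] := displacement_bound.
(* The walk of excursion_of_periodic has excess 2, so it needs more than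
   2 (m + 1) vertices off the geodesic; W is the margin that its n shifts by at
   most M require on both sides of k, and geodesic_shift loses M + 2 at the end
   of the block. *)
pose n := (m.+1 * 2).+1; pose W := n * M + M + 3.
pose N := (size Z * (m.+1 * (M + M)))%N; pose L := W + W + M + 2.
have C_gt0 : 0 < N.+1 * L by rewrite muln_gt0 /L; lia.
exists (N.+1 * L)%N => // x geo; set C := (N.+1 * L)%N in C_gt0 geo *.
apply: contrapT => noex.
pose b k := has (fun z => z * x k \notin mkseq x C.+1) Z.
have hb : count b (iota 1 C) <= N.
  apply: (@count_has_le _ _ (fun z k => z * x k \notin mkseq x C.+1)) => z.
  exact: translate_count.
have [k0 [k0_gt0 k0C good]] := run_of_count hb.
have hiC : k0 + L <= C.+1 by [].
have ex z : exists t, z \in Z -> [/\ t <= 2 * M, t != M &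
    forall k, k0 <= k < k0 + W + W ->
    [/\ M <= k + t, k + t - M <= C & z * x k = x (k + t - M)]].
  case: (boolP (z \in Z)) => [zZ|_]; last by exists 0.
  have [||t [h1 h2 h3]] := @geodesic_shift M C x geo hM z k0 (k0 + L) zZ hiC.
    by rewrite /L; lia.
    by move=> k /good; rewrite -all_predC => /allP/(_ z zZ) /=; rewrite negbK.
  exists t => _; split=> // k hk; apply: h3; rewrite /L; lia.
have [t ht] := choice ex.
apply: noex.
by apply: (@excursion_of_periodic m M C k0 (k0 + W + W) x _ geo _ t ht n _ (k0 + W));
  rewrite // /W /L in hiC *; lia.
Qed.

End Core.

(** * A finite conjugation-invariant set *)

Section FiniteConjugacyClass.
Local Open Scope group_scope.
Local Open Scope classical_set_scope.
Variable Gamma : groupType.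

Lemma lower_central1 (H : set Gamma) n : subgroup H -> lower_central H n 1.
Proof. by case: n => [|n] [H1 _] //= A [[A1 _] _]. Qed.

Lemma finite_of_trivial_finite_index :
  finite_index [set 1 : Gamma] -> finite_set [set: Gamma].
Proof.
move=> fin; apply: sub_finite_set (finite_image (xget (1 : Gamma)) fin) => g _.
exists [set g * h | h in [set 1]]; first by exists g.
have : [set g * h | h in [set 1]] g by exists 1; rewrite ?mulg1.
by move=> /(xgetI 1) [h -> <-]; rewrite mulg1.
Qed.

Lemma commutes_with_last_term (H : set Gamma) n z h :
  lower_central H n.+1 = [set 1] -> lower_central H n z -> H h -> commute z h.
Proof.
move=> trivial hz hh; apply/commgP/eqP.
suff : lower_central H n.+1 [~ z, h] by rewrite trivial.
by apply: sub_gen_smallest; exists z => //; exists h.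
Qed.

(** The conjugate of [z] by [g^-1] depends only on the coset [g H]. *)
Lemma finite_class_of_centralizer (H : set Gamma) z : H 1 -> finite_index H ->
  (forall h, H h -> commute z h) -> finite_set (range (fun g => z ^ g)).
Proof.
move=> H1 fin cz.
pose rep (A : set Gamma) := z ^ (xget (1 : Gamma) A)^-1.
apply: sub_finite_set (finite_image rep fin) => _ [g _ <-].
exists [set g^-1 * h | h in H]; first by exists g^-1.
have : [set g^-1 * h | h in H] g^-1 by exists 1; rewrite ?mulg1.
move=> /(xgetI 1) [h hh]; rewrite /rep => <-.
have /commgP : commute z h^-1 by apply: commuteV; exact: cz.
by rewrite -conjg_fix invgM invgK conjgM => /eqP ->.
Qed.

(** Let [n.+1] be the least index of a trivial term of the lower central series of
    [H]; it is positive, as otherwise [H] would be trivial and [Gamma] finite. A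
    nontrivial [z] in term [n] commutes with [H], so its conjugacy class is finite. *)
Lemma finite_conjugation_invariant_set : virtually_nilpotent Gamma ->
  infinite_set [set: Gamma] ->
  exists Z : seq Gamma, [/\ Z != [::], 1 \notin Z &
    forall g z, z \in Z -> z ^ g \in Z].
Proof.
move=> [H [sH [n0 hn0]] fin] inf.
have ex : exists n, `[< lower_central H n = [set 1] >] by exists n0; apply/asboolP.
case: (ex_minnP ex) => -[|n] /asboolP hn min.
  by move: hn fin => /= -> /finite_of_trivial_finite_index.
have [z hz z1] : exists2 z, lower_central H n z & z != 1.
  apply: contrapT => no.
  suff /asboolP/min : lower_central H n = [set 1] by rewrite ltnn.
  apply/seteqP; split=> z /= hz; last by rewrite hz; exact: lower_central1.
  by apply: contrapT => /eqP z1; apply: no; exists z.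
have /finite_seqP[Z eZ] : finite_set (range (fun g => z ^ g)).
  apply: finite_class_of_centralizer (fin) _ => [|h hh]; first by case: sH.
  exact: commutes_with_last_term hn hz hh.
have mem u : u \in Z <-> exists g, z ^ g = u.
  have -> : (u \in Z) = [set` Z] u :> Prop by [].
  by rewrite -eZ; split=> [[g _ <-]|[g <-]]; exists g.
exists Z; split.
- have : z \in Z by apply/mem; exists 1; rewrite conjg1.
  by apply: contraTneq => ->.
- apply/negP => /mem[g /eqP]; rewrite conjg_eq1; exact/negP.
- by move=> g _ /mem[h <-]; apply/mem; exists (h * g); rewrite conjgM.
Qed.

End FiniteConjugacyClass.

(** * From excursions to detours *)

Section Paths.
Variable G : graph.
Local Open Scope fset_scope.

Definition adj (u v : vertex G) : bool :=
  `[< exists e : edge G, boundary e = [fset u; v] >].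

Lemma adj_sym : symmetric adj.
Proof.
by move=> u v; apply/asboolP/asboolP => -[e he]; exists e; rewrite he fsetUC.
Qed.

Lemma adj_irr : irreflexive adj.
Proof.
move=> u; apply/asboolP => -[e he]; have := card_boundary e.
by rewrite he cardfs2 eqxx.
Qed.

Lemma is_path_cat v (s1 s2 : seq (edge G * vertex G)) :
  is_path v (s1 ++ s2) = is_path v s1 && is_path (last v (unzip2 s1)) s2.
Proof. by elim: s1 v => [|[e w] s1 IH] v //=; rewrite IH andbA. Qed.

Lemma is_path_adj v (st : seq (edge G * vertex G)) :
  is_path v st -> path adj v (unzip2 st).
Proof.
elim: st v => [|[e w] st IH] v //= /andP[/eqP he /IH ->]; rewrite andbT.
by apply/asboolP; exists e.
Qed.

Lemma steps_of_path (E' : rel (vertex G)) (P : pred (edge G)) v t :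
  (forall u w, E' u w -> exists2 e : edge G, boundary e = [fset u; w] & P e) ->
  path E' v t ->
  exists st, [/\ is_path v st, unzip2 st = t & all P (unzip1 st)].
Proof.
move=> hE; elim: t v => [|w t IH] v /=; first by exists [::].
move=> /andP[/hE[e he Pe] /IH[st [h1 h2 h3]]].
by exists ((e, w) :: st); rewrite /= he eqxx h1 h2 Pe h3.
Qed.

Lemma boundary_sub v (st : seq (edge G * vertex G)) e : is_path v st ->
  e \in unzip1 st -> {subset boundary e <= v :: unzip2 st}.
Proof.
elim: st v => [|[f w] st IH] v //= /andP[/eqP hf ps].
rewrite inE => /predU1P[-> | /(IH _ ps) h] u.
  by rewrite hf !inE => /orP[]->; rewrite ?orbT.
by move=> /h; rewrite !inE => /orP[]->; rewrite ?orbT.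
Qed.

(** An edge that occurs again would bring back the vertex it starts from. *)
Lemma uniq_edges v (st : seq (edge G * vertex G)) : is_path v st ->
  uniq (v :: unzip2 st) -> uniq (unzip1 st).
Proof.
elim: st v => [|[e w] st IH] v //= /andP[/eqP he ps] /andP[vn us].
rewrite (IH w ps us) andbT; apply/negP => /(boundary_sub ps) /(_ v).
by rewrite he !inE eqxx /= => /(_ isT); apply/negP; rewrite inE in vn.
Qed.

Lemma card_gedges (p : gpath G) : self_avoiding p -> #|` gedges p| = size (gsteps p).
Proof.
case: p => v st ps /= us; rewrite /gedges /= -(size_map fst st).
have -> : [fset e in unzip1 st] = seq_fset tt (unzip1 st).
  by apply/fsetP => e; rewrite !inE seq_fsetE.
rewrite size_seq_fset undup_id //; exact: (uniq_edges ps).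
Qed.

Lemma card_fset_seq_le (T : choiceType) (s : seq T) (A : {fset T}) :
  {subset A <= s} -> #|` A| <= size s.
Proof. by move=> h; apply: uniq_leq_size. Qed.

Lemma detour_of_card (R : realType) (eps : R) m (p q : gpath G) :
  (1 <= eps * m%:R)%R -> gstart q = gstart p -> gend q = gend p ->
  0 < #|` gedges p `\` gedges q| ->
  m * #|` gedges q `\` gedges p| <= m.+1 * #|` gedges p `\` gedges q| ->
  detour eps p q.
Proof.
move=> hm hs he pos hc; split=> //; first by move=> e; rewrite e fsetDv cardfs0 in pos.
move: hc pos; set A := #|` _|; set B := #|` _|.
rewrite -(ler_nat R) !natrM => hc _.
have m_gt0 : (0 < m%:R :> R)%R.
  rewrite ltr0n lt0n; apply/negP => /eqP m0.
  by move: hm; rewrite m0 mulr0 ler10.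
rewrite -(ler_pM2l m_gt0); apply: (le_trans hc).
rewrite mulrA ler_wpM2r ?ler0n //.
by rewrite mulrDr mulr1 -natr1 lerD2l mulrC.
Qed.

Lemma card_gedges_le (p : gpath G) : #|` gedges p| <= size (gsteps p).
Proof.
rewrite -(size_map fst (gsteps p)); apply: card_fset_seq_le => e.
by rewrite /gedges !inE.
Qed.

Lemma self_avoiding_of_walk v t : path adj v t ->
  exists q : gpath G, [/\ gstart q = v, gend q = last v t, self_avoiding q &
    size (gsteps q) <= size t].
Proof.
case/shortenP => t' pt' ut' sub.
have [|st [ps e _]] := @steps_of_path adj predT v t' _ pt'.
  by move=> u w /asboolP[f hf]; exists f.
exists (GPath ps); rewrite /gend /self_avoiding /gvertices /= e; split=> //.
rewrite -(size_map snd st) -/(unzip2 st) e; apply: uniq_leq_size => //.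
by case/andP: ut'.
Qed.

(** As [q] has fewer edges than [p], it also has fewer edges outside [p] than [p]
    has outside [q]. *)
Lemma detour_of_shortcut (R : realType) (eps : R) (p : gpath G) t :
  (0 < eps)%R -> self_avoiding p -> path adj (gstart p) t ->
  last (gstart p) t = gend p -> size t < size (gsteps p) ->
  exists2 q : gpath G, self_avoiding q & detour eps p q.
Proof.
move=> eps_gt0 sp pt lt st.
have [q [sq eq uq leq]] := self_avoiding_of_walk pt; exists q => //.
have cq := card_gedges_le q; have cp := card_gedges sp.
have hp := cardfsID (gedges q) (gedges p); have hq := cardfsID (gedges p) (gedges q).
rewrite fsetIC in hq.
have lt' : #|` gedges q `\` gedges p| < #|` gedges p `\` gedges q| by lia.
split=> //; [by rewrite eq lt | |].
  by move=> e; move: lt'; rewrite e fsetDv cardfs0.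
apply: (@le_trans _ _ (#|` gedges p `\` gedges q|%:R)%R); first by rewrite ler_nat ltnW.
by rewrite mulrDl mul1r lerDl mulr_ge0 // ltW.
Qed.

Lemma last_take_nth (T : Type) (d v : T) s a : a <= size s ->
  last v (take a s) = nth d (v :: s) a.
Proof. by elim: s v a => [|w s IH] v [|a] //= /IH ->. Qed.

(** Replace the part of [p] between [x a] and [x b] by the excursion, made
    self-avoiding by cutting out its loops. Each of its edges has an endpoint off
    [p], so the [b - a] replaced edges are all lost, and at most the length of the
    excursion is gained. *)
Lemma detour_of_excursion (R : realType) (eps : R) m (p : gpath G) :
  (1 <= eps * m%:R)%R -> self_avoiding p ->
  has_excursion adj m (nth (gstart p) (gvertices p)) (size (gsteps p)) ->
  exists2 q : gpath G, self_avoiding q & detour eps p q.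
Proof.
move=> hm sp [a [b [t [/andP[ab bC] pt tn offt tlen]]]].
have trace : mkseq (nth (gstart p) (gvertices p)) (size (gsteps p)).+1 = gvertices p.
  by rewrite -(size_map snd) -[_.+1]/(size (gvertices p)) mkseq_nth.
rewrite {}trace in offt.
have uV := sp; rewrite /self_avoiding in uV.
case: p sp uV ab bC pt offt tlen => v0 st pst sp; rewrite /gvertices /=.
set V := v0 :: unzip2 st; set x := nth v0 V => uV ab bC pt offt tlen.
have {}uV : uniq V := uV.
have sV : size V = (size st).+1 by rewrite /= size_map.
have aC : a <= size st by exact: leq_trans (ltnW ab) bC.
(* Recording that each step touches a vertex off p makes this survive the
   removal of loops. *)
pose E' u v := adj u v && ((u \notin V) || (v \notin V)).
have pE' : path E' (x a) (rcons t (x b)).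
  case: t tn offt pt {tlen} => // w t _ /= /andP[offw offt] /andP[Ew pt].
  rewrite /E' Ew offw orbT /=.
  elim: t w offw offt pt {Ew} => [|w' t IH] w offw /=.
    by move=> _; rewrite !andbT /E' offw => ->.
  by move=> /andP[offw' offt] /andP[-> pt]; rewrite offw /=; apply: IH.
have xab : x a != x b.
  by rewrite nth_uniq ?sV ?ltnS // ltn_eqF.
have lt : last (x a) (rcons t (x b)) = x b by rewrite last_rcons.
case/shortenP: pE' lt => p' pp' up' sub lp'.
case: (lastP p') pp' up' sub lp' => [|t' w] pp' up' sub lp'.
  by move: xab; rewrite -lp' eqxx.
rewrite last_rcons in lp'; subst w.
have offt' u : u \in t' -> u \notin V.
  move=> ut; have := sub u; rewrite /= !mem_rcons !inE ut orbT => /(_ isT).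
  case/predU1P => [e | /(allP offt)//].
  by move: up'; rewrite /= rcons_uniq -e ut andbF.
have st' : (size t').+1 <= (size t).+1.
  rewrite -(size_rcons t' (x b)) -(size_rcons t (x b)); apply: uniq_leq_size => //.
  by case/andP: up'.
pose P (e : edge G) := [exists u : boundary e, val u \notin V].
have [|exc [pexc eexc Pexc]] := @steps_of_path E' P (x a) (rcons t' (x b)) _ pp'.
  move=> u w /andP[/asboolP[e he] h]; exists e => //; apply/existsP.
  have hu : u \in boundary e by rewrite he !inE eqxx.
  have hw : w \in boundary e by rewrite he !inE eqxx orbT.
  by case/orP: h => h; [exists [` hu] | exists [` hw]].
pose stq := take a st ++ exc ++ drop b st.
have ht c : c <= size st -> last v0 (unzip2 (take c st)) = x c.
  by move=> hc; rewrite /unzip2 map_take (last_take_nth v0) // size_map.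
have pdrop c : c <= size st -> is_path (x c) (drop c st).
  move=> hc; move: (pst); rewrite -{1}(cat_take_drop c st) is_path_cat ht //.
  by case/andP.
have pq : is_path v0 stq.
  rewrite /stq !is_path_cat; apply/and3P; split.
  - by move: (pst); rewrite -{1}(cat_take_drop a st) is_path_cat; case/andP.
  - by rewrite ht.
  - by rewrite ht // eexc last_rcons pdrop.
pose q := GPath pq.
have vq : gvertices q = take a.+1 V ++ t' ++ drop b V.
  rewrite /gvertices /= /stq /unzip2 !map_cat -/(unzip2 exc) eexc map_take map_drop.
  rewrite (drop_nth v0 (n := b) (s := V)); last by rewrite sV ltnS.
  by rewrite cat_rcons.
have sq : self_avoiding q.
  rewrite /self_avoiding vq uniq_catCA cat_uniq; apply/and3P; split.
  - by move: up'; rewrite /= rcons_uniq => /and3P[].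
  - apply/hasPn => u; rewrite mem_cat => h; apply/negP => /offt' /negP; apply.
    by case/orP: h => [/mem_take | /mem_drop].
  - rewrite -(cat_take_drop a.+1 V) in uV.
    move: uV; rewrite !cat_uniq => /and3P[-> h1 h2].
    have e : drop b V = drop (b - a.+1) (drop a.+1 V) by rewrite drop_drop subnK.
    rewrite e (drop_uniq _ h2) andbT /=.
    by apply/hasPn => u /mem_drop hu; exact: (hasPn h1).
exists q => //.
pose es := unzip1 st; have ues : uniq es by exact: (uniq_edges pst).
have eqe : unzip1 stq = take a es ++ unzip1 exc ++ drop b es.
  by rewrite /stq /unzip1 !map_cat map_take map_drop.
pose mid := take (b - a) (drop a es).
have ees : es = take a es ++ mid ++ drop b es.
  have -> : drop b es = drop (b - a) (drop a es) by rewrite drop_drop subnK // ltnW.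
  by rewrite /mid !cat_take_drop.
have offexc e : e \in unzip1 exc -> e \notin es.
  move=> /(allP Pexc) /existsP[u hu]; apply: contra hu => ein.
  exact: (boundary_sub pst ein (fsvalP u)).
have cqp : #|` gedges q `\` gedges (GPath pst)| <= (size t).+1.
  apply: leq_trans (_ : size (unzip1 exc) <= _).
    apply: card_fset_seq_le => e; rewrite /gedges !inE /= eqe.
    rewrite !mem_cat => /andP[ne]; case/or3P => // h.
      by move: ne; rewrite -/es ees mem_cat h.
    by move: ne; rewrite -/es ees !mem_cat h !orbT.
  by rewrite size_map -(size_map snd) -/(unzip2 exc) eexc size_rcons.
have cpq : b - a <= #|` gedges (GPath pst) `\` gedges q|.
  have smid : size mid = b - a.
    by rewrite /mid size_takel // size_drop /es size_map leq_sub2r.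
  rewrite -smid; apply: uniq_leq_size.
    by rewrite take_uniq // drop_uniq.
  move=> e emid; have ein : e \in es by rewrite ees !mem_cat emid orbT.
  rewrite /gedges !inE /= -/es ein andbT eqe !mem_cat !negb_or.
  apply/and3P; split.
  - move: ues; rewrite {1}ees cat_uniq => /and3P[_ /hasPn h _].
    by apply: h; rewrite mem_cat emid.
  - by apply: contraL ein => /offexc.
  - move: ues; rewrite {1}ees !cat_uniq => /and3P[_ _ /and3P[_ /hasPn h _]].
    by apply: contraL emid => /h.
apply: (@detour_of_card R eps m); rewrite //.
- rewrite /gend /= /stq /unzip2 !map_cat !last_cat -/(unzip2 exc) eexc last_rcons.
  rewrite -[X in _ = last _ (map _ X)](cat_take_drop b st) map_cat last_cat.
  by rewrite -/(unzip2 (take b st)) ht.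
- by apply: leq_trans cpq; rewrite subn_gt0.
- apply: leq_trans (leq_trans (leq_mul (leqnn m) cqp) tlen) _.
  exact: leq_mul.
Qed.

End Paths.

(** A shorter connection between two vertices of a shortest path could be spliced
    into it. *)
Lemma geodesic_of_shortest (V : eqType) (E : rel V) (x : nat -> V) C :
  symmetric E -> (forall i, i < C -> E (x i) (x i.+1)) ->
  (forall t, path E (x 0) t -> last (x 0) t = x C -> C <= size t) ->
  geodesic E x C.
Proof.
move=> E_sym Ex short; split=> // i j s.
have up i' j' s' : i' <= j' -> j' <= C -> path E (x i') s' ->
    last (x i') s' = x j' -> j' - i' <= size s'.
  move=> ij jC ps ls.
  have [|p1 l1] := @path_stretch_up _ E x 0 i'.
    by move=> k hk; apply: Ex; lia.
  have [|p2 l2] := @path_stretch_up _ E x j' (C - j').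
    by move=> k hk; apply: Ex; lia.
  have := short ([seq x k | k <- iota 1 i'] ++ s' ++
                 [seq x k | k <- iota j'.+1 (C - j')]).
  rewrite !cat_path !last_cat l1 add0n p1 ps ls p2 l2.
  rewrite !size_cat !size_map !size_iota subnKC //.
  by move=> /(_ isT erefl); lia.
move=> iC jC ps ls; case: (leqP i j) => ij.
  by have := up i j s ij jC ps ls; rewrite /gap; lia.
case: (lastP s) ps ls => [|s' v] ps ls.
  by have := up j i [::] (ltnW ij) iC isT (esym ls); rewrite /gap; lia.
rewrite last_rcons in ls; subst v.
have := up j i _ (ltnW ij) iC (path_rev E_sym ps).
rewrite last_rcons !size_rcons size_rev /gap.
by move=> /(_ erefl); lia.
Qed.

Lemma archimedean_scale (R : realType) (eps : R) : (0 < eps)%R ->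
  exists m, (1 <= eps * m.+1%:R)%R.
Proof.
move=> eps_gt0; have := truncnS_gt eps^-1; set m := Num.truncn _ => hm.
by exists m; rewrite mulrC -ler_pdivrMr // div1r ltW.
Qed.

Lemma admits_detours_of_excursions (R : realType) (G : graph) :
  (forall m, 0 < m -> exists2 C, 0 < C &
    forall x, geodesic (@adj G) x C -> has_excursion (@adj G) m x C) ->
  admits_detours R G.
Proof.
move=> exc eps eps_gt0.
have [m hm] := archimedean_scale eps_gt0.
have [C C_gt0 hC] := exc m.+1 isT; exists C => // p sp lp.
have sC : size (gsteps p) = C by rewrite -card_gedges.
pose x := nth (gstart p) (gvertices p).
have x0 : x 0 = gstart p by [].
have xC : x C = gend p.
  rewrite /x /gend -[gvertices p]/(gstart p :: _) -last_take_nth ?size_map ?sC //.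
  by rewrite take_oversize // size_map sC.
case: (pselect (exists t, [/\ path (@adj G) (x 0) t, last (x 0) t = x C & size t < C])).
  by move=> [t [pt lt st]]; apply: detour_of_shortcut pt _ _; rewrite ?sC // -?xC.
move=> noshort; apply: (detour_of_excursion hm sp); rewrite sC; apply: hC.
apply: geodesic_of_shortest; first exact: adj_sym.
  move=> i iC; have := is_path_adj (gpathP p) => /(pathP (gstart p)); apply.
  by rewrite size_map sC.
move=> t pt lt; rewrite leqNgt; apply/negP => st; apply: noshort.
by exists t.
Qed.

(** * Graphs with two neighbours at each vertex *)

Section Cayley.
Local Open Scope group_scope.
Variables (Gamma : groupType) (Ed : choiceType) (bd : Ed -> {fset Gamma}).
Hypothesis card_bd : forall e, #|` bd e| = 2.
Let G := Graph card_bd.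
Let E : rel Gamma := @adj G.
Hypothesis translate : forall g e, exists f, bd f = [fset g * v | v in bd e]%fset.
Hypothesis translate_parallel : forall g e e', e != e' -> bd e = bd e' ->
  exists f f', [/\ f != f', bd f = [fset g * v | v in bd e]%fset &
                   bd f' = [fset g * v | v in bd e]%fset].
Hypothesis E_conn : forall u v, exists2 s, path E u s & last u s = v.
Hypothesis infinite_Gamma : infinite_set [set: Gamma].

Lemma boundary_pair e : exists u v, bd e = [fset u; v]%fset.
Proof.
have : 0 < #|` bd e| by rewrite card_bd.
rewrite cardfs_gt0 => /fset0Pn[u ue]; exists u.
have := cardfsD1 u (bd e); rewrite card_bd ue => -[] /esym/eqP/cardfs1P[v hv].
by exists v; rewrite -hv fsetD1K.
Qed.

Lemma adj_left g u v : E (g * u) (g * v) = E u v.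
Proof.
have imp h a b : E a b -> E (h * a) (h * b).
  move=> /asboolP[e /= he]; have [f hf] := translate h e.
  by apply/asboolP; exists f; rewrite /= hf he imfset_fset2.
by apply/idP/idP; [move/(imp g^-1); rewrite !mulKg | exact: imp].
Qed.

Lemma closed_total (P : Gamma -> Prop) u : P u ->
  (forall v w, P v -> E v w -> P w) -> forall v, P v.
Proof.
move=> Pu cl v; have [s ps <-] := E_conn u v.
elim: s u Pu ps => [|w s IH] u Pu //= /andP[Euw ps].
by apply: IH ps; exact: cl Euw.
Qed.

Lemma no_finite_closed (s : seq Gamma) u : u \in s ->
  (forall v w, v \in s -> E v w -> w \in s) -> False.
Proof.
move=> us cl; apply: infinite_Gamma; apply: sub_finite_set (finite_seq s) => v _.
exact: (closed_total (P := fun v => v \in s) us cl).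
Qed.

(** With at most one neighbour at [1], the set of [1] and its neighbour would be
    closed under adjacency, hence everything. *)
Lemma neighbours_dichotomy :
  (exists a b c, [/\ E 1 a, E 1 b, E 1 c & uniq [:: a; b; c]]) \/
  (exists a b, a <> b /\ forall v, E 1 v = (v == a) || (v == b)).
Proof.
have E_sym : symmetric E := @adj_sym G.
case: (pselect (exists a, E 1 a)) => [[a Ea]|no]; last first.
  exfalso; apply: (@no_finite_closed [:: 1] 1); rewrite ?mem_head // => v w.
  by rewrite inE => /eqP-> Ew; case: no; exists w.
case: (pselect (exists b, E 1 b /\ b != a)) => [[b [Eb ba]]|no]; last first.
  have only v : E 1 v -> v = a.
    by move=> Ev; apply: contrapT => /eqP va; apply: no; exists v.
  have av : a^-1 = a by apply: only; rewrite -(adj_left a) mulgV mulg1 E_sym.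
  exfalso; apply: (@no_finite_closed [:: 1; a] 1); rewrite ?mem_head // => v w vs Ew.
  move: vs Ew; rewrite !(in_cons, in_nil) orbF => /orP[] /eqP-> Ew.
    by rewrite (only w Ew) eqxx orbT.
  move: Ew; rewrite -(adj_left a^-1) mulVg => /only e.
  by rewrite -[w](mulVKg a) e -{1}av mulVg eqxx.
case: (pselect (exists c, [/\ E 1 c, c != a & c != b])) => [[c [Ec ca cb]]|no].
  left; exists a, b, c; split=> //=.
  by rewrite !inE eq_sym (negbTE ba) eq_sym (negbTE ca) eq_sym cb.
right; exists a, b; split; first by move/eqP: ba => h e; apply: h.
move=> v; apply/idP/orP => [Ev|[]/eqP-> //].
have [|va] := eqVneq v a; first by left.
have [|vb] := eqVneq v b; first by right.
by case: no; exists v.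
Qed.

Section TwoNeighbours.
Variables a b : Gamma.
Hypothesis ab : a <> b.
Hypothesis two : forall v, E 1 v = (v == a) || (v == b).

Lemma two_at u w : E u w = (w == u * a) || (w == u * b).
Proof.
rewrite -(adj_left u^-1) mulVg two.
by rewrite -(inj_eq (mulgI u) _ a) -(inj_eq (mulgI u) _ b) mulVKg.
Qed.

(** The neighbours of [1] are closed under inversion. *)
Lemma two_at_inv u w : E u w = (w == u / a) || (w == u / b).
Proof.
have -> : E u w = E w u := @adj_sym G u w.
by rewrite two_at ![w == _]eq_sym !divg_eq.
Qed.

(** The alternating product u v u v ... with [n] factors. *)
Fixpoint alt (u v : Gamma) (n : nat) : Gamma :=
  if n is k.+1 then alt u v k * (if odd k then v else u) else 1.

(** The bi-infinite walk that keeps leaving a vertex by the neighbour it did not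
    come from. The set of the two neighbours of [1] is closed under inversion, so
    either [b = a^-1], and this is the sequence of powers of [a], or both [a] and
    [b] are involutions; the factors [a], [b^-1], [a], [b^-1], ... serve in both
    cases. *)
Definition line (i : int) : Gamma :=
  match i with Posz n => alt a b^-1 n | Negz n => alt b a^-1 n.+1 end.

End TwoNeighbours.

Lemma alt_neighbours a b (two : forall v, E 1 v = (v == a) || (v == b)) n w :
  E (alt a b^-1 n.+1) w = (w == alt a b^-1 n.+2) || (w == alt a b^-1 n).
Proof.
rewrite /=; case: (odd n) => /=; first by rewrite (two_at two) mulgVK.
by rewrite (two_at_inv two) mulgK orbC.
Qed.

Lemma alt_neq a b n : a <> b -> alt a b^-1 n.+2 <> alt a b^-1 n.
Proof.
move=> ab /= e; apply: ab; move: e.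
case: (odd n) => /=; rewrite -mulgA -[X in _ = X -> _]mulg1 => /mulgI e.
  by apply/esym/(mulgI b^-1); rewrite mulVg.
by apply/(mulIg b^-1); rewrite mulgV.
Qed.

Section Line.
Variables a b : Gamma.
Hypothesis ab : a <> b.
Hypothesis two : forall v, E 1 v = (v == a) || (v == b).
Local Notation x := (line a b).

Lemma line_neighbours i w : E (x i) w = (w == x (i + 1)%R) || (w == x (i - 1)%R).
Proof.
have two' v : E 1 v = (v == b) || (v == a) by rewrite two orbC.
case: i => [[|n]|n].
- by rewrite -[LHS]/(E 1 w) two -[x (0 + 1)%R]/(1 * a) -[x (0 - 1)%R]/(1 * b) !mul1g.
- have -> : (Posz n.+1 + 1 = n.+2)%R by lia.
  have -> : (Posz n.+1 - 1 = n)%R by lia.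
  exact: alt_neighbours.
- have -> : (Negz n - 1 = Negz n.+1)%R by lia.
  rewrite orbC /line; case: n => [|n].
    have -> : (Negz 0 + 1 = Posz 0)%R by lia.
    exact: alt_neighbours two' 0 w.
  have -> : (Negz n.+1 + 1 = Negz n)%R by lia.
  exact: alt_neighbours two' n.+1 w.
Qed.

Lemma line_turn i : x (i + 1)%R <> x (i - 1)%R.
Proof.
have ba : b <> a by move=> e; apply: ab.
case: i => [[|n]|n].
- by rewrite -[x (0 + 1)%R]/(1 * a) -[x (0 - 1)%R]/(1 * b) !mul1g.
- have -> : (Posz n.+1 + 1 = n.+2)%R by lia.
  have -> : (Posz n.+1 - 1 = n)%R by lia.
  exact: alt_neq.
- have -> : (Negz n - 1 = Negz n.+1)%R by lia.
  move=> /esym; rewrite /line; case: n => [|n].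
    have -> : (Negz 0 + 1 = Posz 0)%R by lia.
    exact: (@alt_neq b a 0).
  have -> : (Negz n.+1 + 1 = Negz n)%R by lia.
  exact: (@alt_neq b a n.+1).
Qed.

Lemma line_surj v : exists i, x i = v.
Proof.
move: v; apply: (@closed_total _ 1); first by exists 0%R.
move=> _ w [i <-]; rewrite line_neighbours => /orP[]/eqP ->; first by exists (i + 1)%R.
by exists (i - 1)%R.
Qed.

Lemma line_step i : E (x i) (x (i + 1)%R).
Proof. by rewrite line_neighbours eqxx. Qed.

(** Take a coincidence of two points at the smallest possible distance along the
    line. By minimality the line closes up smoothly there, so the points between
    form a finite set closed under adjacency. *)
Lemma line_inj : injective x.
Proof.
suff main (i : int) (d : nat) : x i <> x (i + d.+1%:Z)%R.
  move=> i j e; have [ij|ij|//] := ltgtP i j; exfalso.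
    have /main : x i = x (i + (absz (j - i - 1)%R).+1%:Z)%R.
      by rewrite e; congr line; lia.
    by [].
  have /main : x j = x (j + (absz (i - j - 1)%R).+1%:Z)%R.
    by rewrite -e; congr line; lia.
  by [].
move=> e0.
have ex : exists d : nat, `[< exists i, x i = x (i + d.+1%:Z)%R >].
  by exists d; apply/asboolP; exists i.
case: (ex_minnP ex) => {}d /asboolP[{}i {}e0] min {ex}.
have {}min (d' : nat) j : x j = x (j + d'.+1%:Z)%R -> d <= d'.
  by move=> h; apply: min; apply/asboolP; exists j.
have E_irr : irreflexive E := @adj_irr G.
have d1 : 1 < d.
  case: d e0 {min} => [|[|d]] // e0.
    by have := line_step i; rewrite -e0 E_irr.
  have := @line_turn (i + 1)%R; rewrite -addrA (_ : i + 1 - 1 = i)%R; last lia.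
  by rewrite e0.
have last_in : x (i - 1)%R = x (i + d%:Z)%R.
  have : E (x i) (x (i - 1)%R) by rewrite line_neighbours eqxx orbT.
  rewrite e0 line_neighbours => /orP[/eqP e|/eqP ->]; last by congr line; lia.
  have : E (x (i + d.+1%:Z)%R) (x (i + d%:Z)%R).
    by rewrite line_neighbours; apply/orP; right; apply/eqP; congr line; lia.
  rewrite -e0 line_neighbours => /orP[/eqP e'|/eqP //].
  have : d <= d.-2.
    apply: (min _ (i + 1)%R); rewrite -e'; congr line; lia.
  lia.
apply: (@no_finite_closed [seq x (i + k%:Z)%R | k <- iota 0 d.+1] (x i)).
  by apply/mapP; exists 0; rewrite ?mem_iota //; congr line; lia.
move=> v w /mapP[k]; rewrite mem_iota => hk ->.
rewrite line_neighbours => /orP[]/eqP ->.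
  have [kd|kd] := ltnP k d.
    by apply/mapP; exists k.+1; rewrite ?mem_iota; [lia|congr line; lia].
  apply/mapP; exists 0; rewrite ?mem_iota //.
  rewrite -[RHS]/(x (i + 0%:Z)%R) addr0 e0; congr line; lia.
case: k hk => [|k] hk.
  apply/mapP; exists d; rewrite ?mem_iota; first lia.
  by rewrite -last_in; congr line; lia.
by apply/mapP; exists k; rewrite ?mem_iota; [lia|congr line; lia].
Qed.

(** Both edges and integers [n] correspond to the pairs of [line n] and
    [line (n + 1)]. *)
Lemma line_isomorphic : injective bd -> graph_isomorphic G standard_int_graph.
Proof.
move=> bd_inj.
have [phi hphi] : exists phi : Gamma -> int, forall v, x (phi v) = v.
  by have [phi h] := choice line_surj; exists phi.
have phix i : phi (x i) = i by apply: line_inj; rewrite hphi.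
have [edge_at h_at] : exists g : int -> Ed,
    forall n, bd (g n) = [fset x n; x (n + 1)%R]%fset.
  suff /choice[g hg] : forall n, exists e, bd e = [fset x n; x (n + 1)%R]%fset.
    by exists g.
  by move=> n; have /asboolP[e he] := line_step n; exists e.
have at_inj n m : bd (edge_at n) = bd (edge_at m) -> n = m.
  rewrite !h_at => e.
  have : x n \in [fset x m; x (m + 1)%R]%fset by rewrite -e !inE eqxx.
  have : x m \in [fset x n; x (n + 1)%R]%fset by rewrite e !inE eqxx.
  by rewrite !inE !(inj_eq line_inj); lia.
have at_surj e : exists n, edge_at n = e.
  have [u [v he]] := boundary_pair e.
  have [i xi] := line_surj u.
  have : E u v by apply/asboolP; exists e.
  rewrite -xi line_neighbours => /orP[]/eqP hv.
    by exists i; apply: bd_inj; rewrite h_at he -xi hv.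
  exists (i - 1)%R; apply: bd_inj; rewrite h_at he -xi hv fsetUC.
  by congr [fset line _ _ _; _]%fset; lia.
have [psi hpsi] := choice at_surj.
exists phi, psi; split.
- by exists x.
- by exists edge_at => // n; apply: at_inj; rewrite hpsi.
- move=> e; rewrite -[e in RHS]hpsi /= h_at imfset_fset2 !phix.
  by [].
Qed.

(** By transitivity one of the two edges at the middle vertex of a path of length
    2 has a parallel edge, and they can be exchanged. *)
Lemma admits_detours_of_parallel (R : realType) e e' :
  e != e' -> bd e = bd e' -> admits_detours R G.
Proof.
move=> ne eq_bd eps eps_gt0; exists 2 => // p sp lp.
have [m hm] := archimedean_scale eps_gt0.
have : size (gsteps p) = 2 by rewrite -card_gedges.
case: p sp {lp} => x0 [|[e1 x1] [|[e2 x2] [|? ?]]] // pst sp _.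
have := pst; rewrite /= andbT => /andP[/eqP h1 /eqP h2].
have ue : e1 != e2 by have := uniq_edges pst sp; rewrite /= inE andbT.
have /and3P[] := sp; rewrite /= !inE negb_or => /andP[x01 x02] x12 _.
have E10 : E x1 x0 by rewrite /E adj_sym; apply/asboolP; exists e1.
have E12 : E x1 x2 by apply/asboolP; exists e2.
have only w : E x1 w -> (w == x0) || (w == x2).
  move: E10 E12; rewrite !(two_at two) => /orP[]/eqP h0 /orP[]/eqP h2' /orP[]/eqP ->;
    rewrite ?h0 ?h2' ?eqxx ?orbT //; by move: x02; rewrite h0 h2' eqxx.
have swap (q : gpath G) d d' : self_avoiding q -> gstart q = x0 -> gend q = x2 ->
    d \in [:: e1; e2] -> d \notin unzip1 (gsteps q) ->
    {subset unzip1 (gsteps q) <= [:: d'; e1; e2]} -> detour eps (GPath pst) q.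
  move=> sq q0 q2 din dout sub.
  have c1 : 0 < #|` (gedges (GPath pst) `\` gedges q)%fset|.
    rewrite cardfs_gt0; apply/fset0Pn; exists d.
    by rewrite /gedges !inE dout /= -[_ || _]/(d \in [:: e1; e2]).
  have c2 : #|` (gedges q `\` gedges (GPath pst))%fset| <= 1.
    apply: (@card_fset_seq_le _ [:: d']) => f; rewrite /gedges !inE /=.
    by move=> /andP[fn /sub]; move: fn; rewrite !inE;
      case: (f == d'); case: (f == e1); case: (f == e2).
  apply: (detour_of_card hm) => //.
  apply: leq_trans (leq_mul (leqnn m.+1) c2) _.
  exact: leq_mul.
have [u [v huv]] := boundary_pair e.
have [f [f' [nff hf hf']]] := translate_parallel (x1 / u) ne eq_bd.
rewrite huv imfset_fset2 mulgVK in hf hf'; set w := x1 / u * v in hf hf'.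
have /only : E x1 w by apply/asboolP; exists f.
have pick d : exists g, g != d /\ bd g = [fset x1; w]%fset.
  have [fd|fd] := eqVneq f d; last by exists f.
  by exists f'; rewrite -fd eq_sym.
case/orP => /eqP ew; rewrite ew in pick.
- have [g [g1 hg]] := pick e1.
  have pq : @is_path G x0 [:: (g, x1); (e2, x2)].
    by rewrite /= hg h2 [in X in X && _]fsetUC !eqxx.
  exists (GPath pq) => //; apply: (swap _ e1 g) => //; rewrite ?mem_head //=.
    by rewrite !inE negb_or eq_sym g1.
  by move=> z; rewrite !inE => /orP[]->; rewrite ?orbT.
- have [g [g2 hg]] := pick e2.
  have pq : @is_path G x0 [:: (e1, x1); (g, x2)].
    by rewrite /= hg h1 !eqxx.
  exists (GPath pq) => //; apply: (swap _ e2 g) => //; rewrite ?inE ?eqxx ?orbT //=.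
    by rewrite negb_or eq_sym ue eq_sym g2.
  by move=> z; rewrite !inE => /orP[]->; rewrite ?orbT.
Qed.

End Line.

(** * Cayley graphs *)

Lemma cayley_admits_detours (R : realType) : virtually_nilpotent Gamma ->
  ~ graph_isomorphic G standard_int_graph -> admits_detours R G.
Proof.
move=> vn notZ.
have [Z [Z0 Z1 Zconj]] := finite_conjugation_invariant_set vn infinite_Gamma.
case: neighbours_dichotomy => [three | [a [b [ab two]]]].
  apply: admits_detours_of_excursions => m m_gt0.
  exact: (geodesic_excursions adj_left (@adj_sym G) (@adj_irr G) E_conn Zconj Z1).
case: (pselect (exists e e', e != e' /\ bd e = bd e')) => [[e [e' [ne eq_bd]]]|no].
  exact: (admits_detours_of_parallel two ne eq_bd).
exfalso; apply: notZ; apply: (line_isomorphic ab two) => e e' h.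
by apply: contrapT => /eqP ne; apply: no; exists e, e'.
Qed.

End Cayley.

Section CayleyGraphs.
Local Open Scope group_scope.
Local Open Scope classical_set_scope.
Variables (Gamma : groupType) (S : finType) (f : S -> Gamma).
Hypothesis f_neq1 : forall s, f s != 1.
Hypothesis f_gen : generated_subgroup (range f) = [set: Gamma].

Lemma cayley_boundary_translate g e :
  cayley_boundary f (g * e.1, e.2) = [fset g * v | v in cayley_boundary f e]%fset.
Proof. by rewrite imfset_fset2 mulgA. Qed.

(** The vertices that can be reached from [1] form a subgroup. *)
Lemma cayley_connected (E : rel Gamma) : symmetric E ->
  (forall g u v, E (g * u) (g * v) = E u v) -> (forall s, E 1 (f s)) ->
  forall u v, exists2 t, path E u t & last u t = v.
Proof.
move=> E_sym E_left Ef u v.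
have from1 w : exists2 t, path E 1 t & last 1 t = w.
  pose H : set Gamma := [set w | exists2 t, path E 1 t & last 1 t = w].
  have : generated_subgroup (range f) `<=` H.
    apply: smallest_sub.
      split=> [|y z [t pt lt] [s ps ls]]; first by exists [::].
      have [r pr lr] : exists2 r, path E z r & last z r = 1.
        case: (lastP s) ps ls => [|s' z'] ps; first by move=> <-; exists [::].
        rewrite last_rcons => ez; rewrite ez in ps.
        by exists (rcons (rev s') 1); [exact: path_rev | rewrite last_rcons].
      exists (t ++ [seq y / z * h | h <- r]).
        by rewrite cat_path pt lt -[y in path _ y _](mulgVK z) (path_mulg E_left).
      by rewrite last_cat lt -[y in last y](mulgVK z) last_map lr mulg1.
    by move=> _ [s _ <-]; exists [:: f s]; rewrite //= Ef.
  by rewrite f_gen => /(_ w I).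
have [t pt lt] := from1 (u^-1 * v).
exists [seq u * h | h <- t].
  by rewrite -[u in path _ u _]mulg1 (path_mulg E_left).
by rewrite -[u in last u]mulg1 last_map lt mulVKg.
Qed.

Lemma unreduced_admits_detours (R : realType) : virtually_nilpotent Gamma ->
  infinite_set [set: Gamma] ->
  ~ graph_isomorphic (unreduced_cayley_graph f_neq1) standard_int_graph ->
  admits_detours R (unreduced_cayley_graph f_neq1).
Proof.
move=> vn inf notZ.
have tr g (e : Gamma * S) : exists e',
    cayley_boundary f e' = [fset g * v | v in cayley_boundary f e]%fset.
  by exists (g * e.1, e.2); exact: cayley_boundary_translate.
apply: (@cayley_admits_detours Gamma _ (cayley_boundary f)) => //.
  move=> g e e' ne eq_bd; exists (g * e.1, e.2), (g * e'.1, e'.2).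
  rewrite !cayley_boundary_translate eq_bd; split=> //.
  by case: e e' ne {eq_bd} => [h s] [h' s']; rewrite !xpair_eqE (inj_eq (mulgI g)).
apply: cayley_connected.
- exact: (@adj_sym (unreduced_cayley_graph f_neq1)).
- exact: (adj_left _ tr).
- move=> s; apply/asboolP; exists (1, s).
  by rewrite /= /cayley_boundary /= mul1g.
Qed.

Lemma reduced_admits_detours (R : realType) : virtually_nilpotent Gamma ->
  infinite_set [set: Gamma] ->
  ~ graph_isomorphic (reduced_cayley_graph f_neq1) standard_int_graph ->
  admits_detours R (reduced_cayley_graph f_neq1).
Proof.
move=> vn inf notZ; pose H := unreduced_cayley_graph f_neq1.
have ex (e : Gamma * S) : exists e' : simple_edge H, val e' = cayley_boundary f e.
  have he : `[< exists e', boundary (g := H) e' = cayley_boundary f e >].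
    by apply/asboolP; exists e.
  by exists (Sub (cayley_boundary f e) he); rewrite SubK.
have tr g (e : simple_edge H) : exists e' : simple_edge H,
    val e' = [fset g * v | v in val e]%fset.
  have /asboolP[d hd] := valP e; have [e' he'] := ex (g * d.1, d.2).
  by exists e'; rewrite he' -hd cayley_boundary_translate.
apply: (@cayley_admits_detours Gamma (simple_edge H) val) => //.
  by move=> g e e' /eqP ne /val_inj.
apply: cayley_connected.
- exact: (@adj_sym (reduced_cayley_graph f_neq1)).
- exact: (adj_left _ tr).
- move=> s; have [e' he'] := ex (1, s); apply/asboolP; exists e'.
  by rewrite /= he' /cayley_boundary /= mul1g.
Qed.

End CayleyGraphs.

Local Open Scope classical_set_scope.

Theorem theoremA1 (R : realType) (Gamma : groupType) (G : graph)
    (hG : cayley_graph Gamma G)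
    (hvn : virtually_nilpotent Gamma)
    (hinf : infinite_set [set: vertex G])
    (hZ : ~ graph_isomorphic G standard_int_graph) :
  admits_detours R G.
Proof.
case: hG hinf hZ => S f f_neq1 f_gen hinf hZ.
- exact: unreduced_admits_detours.
- exact: reduced_admits_detours.
Qed.
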